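(* Let $n>d\ge3$ and let $\mathcal{T}=(T_i)_{i=d}^{n-1}$ be a BBC sequence of simplicial $(d-1)$-balls (neighborly or not) such that the cubical $d$-sphere $\mathrm{BBC}(\mathcal{T})$ is polytopal, i.e. combinatorially isomorphic to the boundary complex of a convex $(d+1)$-polytope. Then the simplicial $(d-2)$-sphere $\partial T_{n-1}$ is polytopal, i.e. combinatorially isomorphic to the boundary complex of a convex $(d-1)$-polytope.
   Context: Faces of the $m$-cube $C_m=[-1,1]^m$ correspond to sign vectors $\sigma\in\{0,\pm1\}^m$ ($\sigma\leftrightarrow\{x\in C_m:x_j=\sigma_j\text{ whenever }\sigma_j\neq0\}$). For $\sigma\in\{0,\pm1\}^m$, $|\sigma|=(|\sigma_1|,\ldots,|\sigma_m|)$. A simplicial complex $\Delta$ on $[m]$ is encoded by identifying a face $\phi$ with the characteristic vector of $[m]\setminus\phi$; ''$|\sigma|\in\Delta$'' means the zero set of $\sigma$ is a face of $\Delta$. Mirror complex: $M(\Delta)=\{\sigma\in\{0,\pm1\}^m:|\sigma|\in\Delta\}$. BBC sequence: a sequence $(T_i)_{i=d}^{n-1}$ of simplicial $(d-1)$-balls, $T_i$ with vertex set $[i]$, $T_d$ the $(d-1)$-simplex on $[d]$, and for $i=d+1,\ldots,n-1$, $T_i=B_{i-1}*\{i\}$ (cone with apex $i$) where $B_{i-1}$ is a simplicial $(d-2)$-ball with vertex set $[i-1]$ contained in $\partial T_{i-1}$. $\mathrm{BBC}(\mathcal{T})$: $S_{d+1}$ is the boundary complex of $C_{d+1}$; for $k=d+2,\ldots,n$,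 with $R_{k-1}$ the subcomplex of $S_{k-1}$ formed by all faces of facets of $S_{k-1}$ not in $M(T_{k-1})$, $S_k=\{(\sigma,+1):\sigma\in M(T_{k-1})\}\cup\{(\sigma,0):\sigma\in M(\partial T_{k-1})\}\cup\{(\sigma,-1):\sigma\in R_{k-1}\}$; $\mathrm{BBC}(\mathcal{T})=S_n$, a cubical $d$-sphere. *)

(* Defs.v *)
From HB Require Import structures.
From mathcomp Require Import all_boot all_order all_algebra.

Set Implicit Arguments.
Unset Strict Implicit.
Unset Printing Implicit Defensive.

(* The ground set [m] is 'I_m: the vertex i, 1 <= i <= m, is the ordinal i - 1. *)

Definition simplicial_complex m (D : {set {set 'I_m}}) : Prop :=
  set0 \in D /\ forall F G : {set 'I_m}, G \in D -> F \subset G -> F \in D.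

Definition all_vertices m (D : {set {set 'I_m}}) : Prop :=
  forall i : 'I_m, [set i] \in D.

Definition full_simplex m : {set {set 'I_m}} := [set: {set 'I_m}].

(* Boundary of an e-dimensional ball: generated by the (e - 1)-faces (those
   with e vertices) lying in exactly one e-face. *)
Definition bdry (e : nat) m (D : {set {set 'I_m}}) : {set {set 'I_m}} :=
  [set F : {set 'I_m} | [exists G in D,
    [&& #|G| == e, F \subset G &
        #|[set H in D | (#|H| == e.+1) && (G \subset H)]| == 1]]].

(* Cone over D with the new vertex ord_max as apex: F is a face iff F minus the
   apex is a face of D. *)
Definition cone m (D : {set {set 'I_m}}) : {set {set 'I_m.+1}} :=
  [set F : {set 'I_m.+1} | [set j : 'I_m | widen_ord (leqnSn m) j \in F] \in D].

(* {0, +1, -1} is encoded as {None, Some true, Some false}. *)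
Definition sign := option bool.
Definition sg0 : sign := None.
Definition sgP : sign := Some true.
Definition sgM : sign := Some false.

Definition signvec m := {ffun 'I_m -> sign}.

Definition zeros m (s : signvec m) : {set 'I_m} := [set j | s j == sg0].

(* Inclusion of the faces of the cube [-1, 1]^m encoded by s and t. *)
Definition sv_le m (s t : signvec m) : bool :=
  [forall j, (t j != sg0) ==> (s j == t j)].

Definition sv_rcons m (s : signvec m) (e : sign) : signvec m.+1 :=
  [ffun j => if unlift ord_max j is Some i then s i else e].

Definition mirror m (D : {set {set 'I_m}}) : {set signvec m} :=
  [set s | zeros s \in D].

Definition cube_bdry m : {set signvec m} := [set s | zeros s != [set: 'I_m]].

Definition sv_facets m (S : {set signvec m}) : {set signvec m} :=
  [set t in S | [forall u in S, sv_le t u ==> (u == t)]].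

Definition remainder m (D : {set {set 'I_m}}) (S : {set signvec m}) :
    {set signvec m} :=
  [set s in S | [exists t in sv_facets S, (t \notin mirror D) && sv_le s t]].

(* bbc_sphere d T k is S_k; it is meaningful for k >= d + 1 only. *)
Fixpoint bbc_sphere (d : nat) (T : forall i, {set {set 'I_i}}) k :
    {set signvec k} :=
  match k return {set signvec k} with
  | 0 => set0
  | k'.+1 =>
    if k' <= d then cube_bdry k'.+1 else
        [set sv_rcons s sgP | s in mirror (T k')]
    :|: [set sv_rcons s sg0 | s in mirror (bdry d.-1 (T k'))]
    :|: [set sv_rcons s sgM | s in remainder (T k') (bbc_sphere d T k')]
  end.

(* Faces of a simplicial complex other than the empty one, which has no
   counterpart among sign vectors. *)
Definition nonempty_faces m (D : {set {set 'I_m}}) : {set {set 'I_m}} :=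
  D :\ set0.

Definition face_le m (F G : {set 'I_m}) : bool := F \subset G.

From mathcomp Require Import all_classical all_reals topology normedtype.

Import Order.TTheory GRing.Theory Num.Theory.
Import numFieldNormedType.Exports.
Local Open Scope classical_set_scope.
Local Open Scope ring_scope.

Definition homeomorphic (X Y : topologicalType) (A : set X) (B : set Y) :
    Prop :=
  exists (f : X -> Y) (g : Y -> X),
    [/\ {within A, continuous f} /\ {within B, continuous g},
        set_fun A B f, set_fun B A g,
        forall x, A x -> g (f x) = x & forall y, B y -> f (g y) = y].

(* Geometric realization inside the standard simplex of R^m. *)
Definition realization (R : realType) m (D : {set {set 'I_m}}) :
    set 'rV[R]_m :=
  [set x : 'rV[R]_m | [/\ forall i, 0 <= x 0 i, \sum_i x 0 i = 1
             & finset (fun i => x 0 i != 0) \in D]].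

Definition euclidean_ball (R : realType) (e : nat) : set 'rV[R]_e :=
  [set x : 'rV[R]_e | \sum_i x 0 i ^+ 2 <= 1].

Definition simplicial_ball (R : realType) (e : nat) m (D : {set {set 'I_m}}) :
    Prop :=
  simplicial_complex D /\
  homeomorphic (@realization R m D) (@euclidean_ball R e).

(* Only the values T i with d <= i < n matter. *)
Definition bbc_sequence (R : realType) (d n : nat)
    (T : forall i, {set {set 'I_i}}) : Prop :=
  [/\ forall i, (d <= i < n)%N ->
        simplicial_ball R d.-1 (T i) /\ all_vertices (T i),
      T d = full_simplex d
    & forall i, (d <= i)%N -> (i.+1 < n)%N ->
        exists B : {set {set 'I_i}},
          [/\ simplicial_ball R d.-2 B, all_vertices B,
              B \subset bdry d.-1 (T i) & T i.+1 = cone B]].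

(* The points are the rows of V. *)
Definition conv_hull (R : realType) p N (V : 'M[R]_(p, N)) : set 'rV[R]_N :=
  [set x | exists w : 'rV[R]_p,
     [/\ forall i, 0 <= w 0 i, \sum_i w 0 i = 1 & x = w *m V]].

(* The affine hull of the rows v_0, ..., v_p of V has direction space spanned
   by the differences v_i - v_0. *)
Definition aff_dim (R : realType) p N (V : 'M[R]_(p.+1, N)) : nat :=
  \rank (\matrix_(i < p.+1) (row i V - row ord0 V)).

Definition is_polytope (R : realType) (k : nat) N (P : set 'rV[R]_N) : Prop :=
  exists p (V : 'M[R]_(p.+1, N)), aff_dim V = k /\ P = conv_hull V.

Definition dotv (R : realType) N (c x : 'rV[R]_N) : R := \sum_i c 0 i * x 0 i.

Definition is_face (R : realType) N (P F : set 'rV[R]_N) : Prop :=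
  exists (c : 'rV[R]_N) (b : R),
    (forall x, P x -> dotv c x <= b) /\ F = P `&` [set x | dotv c x = b].

Definition bdry_faces (R : realType) N (P : set 'rV[R]_N) :
    set (set 'rV[R]_N) :=
  [set F | [/\ is_face P F, F !=set0 & F <> P]].

(* The poset (A, le) of nonempty faces is isomorphic to the poset of nonempty
   proper faces of a convex k-polytope. *)
Definition polytopal (R : realType) (k : nat) (X : finType) (le : rel X)
    (A : {set X}) : Prop :=
  exists N (P : set 'rV[R]_N), is_polytope k P /\
  exists phi : X -> set 'rV[R]_N,
    set_bij [set` A] (bdry_faces P) phi /\
    forall x y, x \in A -> y \in A -> (le x y <-> phi x `<=` phi y).

(* Main.v *)
Require Import Defs.
From mathcomp Require Import all_boot all_order all_algebra all_reals.
From mathcomp Require Import lra.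
From mathcomp Require boolp classical_sets.

Set Implicit Arguments.
Unset Strict Implicit.
Unset Printing Implicit Defensive.

(** Let P be a (d+1)-polytope realizing S_n.  The faces of S_n above the sign
    vector e = (+, ..., +, 0) are the (s, 0) with s nonnegative and zero set in
    the boundary of T_(n-1), so that boundary is the boundary complex of the
    face figure P/e, of dimension d + 1 - 1 - dim e.  Since consecutive faces of
    a polytope differ in dimension by one, the dimension of the face of P
    given by a sign vector is at most its number of zeros; hence dim e = 1, as
    e contains the vertex (+, ..., +, +).

    That e belongs to S_n, i.e. that T_(n-1) has a nonempty boundary, also
    follows from polytopality: a facet of P above (+, ..., +, +) has dimension
    d, so its sign vector has at least d zeros.  Unless its last sign is 0, its
    zero set is a face of T_(n-1) with d vertices, and for a cone T_(n-1) the
    intersection of that face with the base is a boundary ridge. *)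

(** * Faces of a polyhedral cone given by the rows of a matrix *)

Section LinearFaces.
Import Order.TTheory GRing.Theory Num.Theory.
Local Open Scope ring_scope.
Variable R : realFieldType.

(* For the homogenized vertices of a polytope these are exactly the vertex sets
   of its faces; lin_face U set0 says that the rows of U lie in an open
   half-space. *)
Definition lin_face p N (U : 'M[R]_(p, N)) (I : {set 'I_p}) : Prop :=
  exists c : 'cV[R]_N, forall i, (U *m c) i 0 <= 0 ?= iff (i \in I).

(** Rows outside [I] are zeroed, not deleted, so that the matrices of nested faces keep one shape;
    the row space is the span of the face. *)
Definition keep_rows p N (I : {set 'I_p}) (U : 'M[R]_(p, N)) : 'M[R]_(p, N) :=
  diag_mx (\row_i (i \in I)%:R) *m U.

(* The columns span the functionals vanishing on the rows of A. *)
Definition ann p N (A : 'M[R]_(p, N)) : 'M[R]_N := (kermx A^T)^T.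

Lemma keep_rowsE p N (I : {set 'I_p}) (U : 'M[R]_(p, N)) i j :
  keep_rows I U i j = (i \in I)%:R * U i j.
Proof. by rewrite /keep_rows mul_diag_mx !mxE. Qed.

Lemma keep_rows_mul p N M (I : {set 'I_p}) (U : 'M[R]_(p, N))
    (c : 'M[R]_(N, M)) :
  keep_rows I U *m c = keep_rows I (U *m c).
Proof. by rewrite /keep_rows mulmxA. Qed.

Lemma keep_rows_sub p N (K I : {set 'I_p}) (U : 'M[R]_(p, N)) :
  K \subset I -> keep_rows K (keep_rows I U) = keep_rows K U.
Proof.
move=> KI; apply/matrixP=> i j; rewrite !keep_rowsE.
by case: (boolP (i \in K)) => [/(subsetP KI) ->|_]; rewrite ?mul1r ?mul0r.
Qed.

Lemma keep_rowsT p N (U : 'M[R]_(p, N)) : keep_rows [set: 'I_p] U = U.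
Proof. by apply/matrixP=> i j; rewrite keep_rowsE inE mul1r. Qed.

Lemma keep_rows0 p N (U : 'M[R]_(p, N)) : keep_rows set0 U = 0.
Proof. by apply/matrixP=> i j; rewrite keep_rowsE inE mul0r mxE. Qed.

Lemma mulmx_ann p N (A : 'M[R]_(p, N)) : A *m ann A = 0.
Proof. by apply: trmx_inj; rewrite /ann trmx_mul trmxK mulmx_ker trmx0. Qed.

Lemma annP p N (A : 'M[R]_(p, N)) (c : 'cV[R]_N) :
  A *m c = 0 -> exists y, c = ann A *m y.
Proof.
move=> Ac; have /submxP[D cD] : (c^T <= kermx A^T)%MS.
  by apply/sub_kermxP; rewrite -trmx_mul Ac trmx0.
by exists D^T; apply: trmx_inj; rewrite trmx_mul trmxK /ann trmxK.
Qed.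

Lemma mxrank_ker_ann p N (A : 'M[R]_(p, N)) : \rank (kermx (ann A)) = \rank A.
Proof.
by rewrite mxrank_ker /ann mxrank_tr mxrank_ker mxrank_tr subKn ?rank_leq_col.
Qed.

(** Right multiplication by [ann A] is the quotient by the row space of [A], since its kernel is the
    double annihilator of [A], that is, this row space. *)
Lemma mxrank_mul_ann p q N (A : 'M[R]_(p, N)) (B : 'M[R]_(q, N)) :
  (A <= B)%MS -> \rank (B *m ann A) = (\rank B - \rank A)%N.
Proof.
move=> AB; rewrite -(mxrank_mul_ker B (ann A)) -[X in (_ - X)%N]mxrank_ker_ann.
have sAk : (A <= kermx (ann A))%MS by apply/sub_kermxP; exact: mulmx_ann.
have eAk : (kermx (ann A) <= A)%MS.
  by have [_ <-] := mxrank_leqif_sup sAk; rewrite mxrank_ker_ann.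
have/capmx_idPr-> : (kermx (ann A) <= B)%MS by exact: submx_trans eAk AB.
by rewrite addnK.
Qed.

Lemma mxrank_le_mul_ann p q N (A : 'M[R]_(p, N)) (B : 'M[R]_(q, N)) :
  (\rank B <= \rank A + \rank (B *m ann A))%N.
Proof.
rewrite -(mxrank_mul_ker B (ann A)) addnC leq_add2r.
rewrite -[X in (_ <= X)%N]mxrank_ker_ann.
exact/mxrankS/capmxSr.
Qed.

(* A functional exposing K inside I is tilted by a large multiple of one
   exposing I. *)
Lemma lin_face_trans p N (U : 'M[R]_(p, N)) (I K : {set 'I_p}) (y : 'cV[R]_N) :
  lin_face U I -> K \subset I ->
  (forall i, i \in I -> (U *m y) i 0 <= 0 ?= iff (i \in K)) -> lin_face U K.
Proof.
move=> [c cI] KI yK.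
pose r i := `|(U *m y) i 0| / - (U *m c) i 0.
have r_ge0 i : 0 <= r i.
  by rewrite divr_ge0 // oppr_ge0; exact: (cI i).1.
(* Exceeding every [r i], the multiple [t] makes the tilted value negative at each row outside [I].
   On [I] the divisor is 0, so [r i] is 0 there. *)
pose t := 1 + \sum_i r i.
exists (y + t *: c) => i.
rewrite mulmxDr -scalemxAr !mxE -!/((U *m _) i 0).
have [iI|iI] := boolP (i \in I).
  have/eqP : ((U *m c) i 0 == 0) by rewrite (cI i).2.
  rewrite mxE => ->; rewrite mulr0 addr0.
  by have := yK i iI; rewrite mxE.
have ciN : (U *m c) i 0 < 0 by rewrite lt_neqAle (cI i).2 (negbTE iI) (cI i).1.
have iK : i \notin K by apply: contra iI; exact: (subsetP KI).
rewrite (negbTE iK).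
have rt : r i < t.
  rewrite /t (bigD1 i) //= addrCA ltrDl ltr_pwDl //.
  by apply: sumr_ge0.
have lt0 : (U *m y) i 0 + t * (U *m c) i 0 < 0.
  have := rt; rewrite /r ltr_pdivrMr ?oppr_gt0 // mulrN => h.
  have := ler_norm ((U *m y) i 0); lra.
rewrite !mxE in lt0.
by split; [exact: ltW | rewrite lt_eqF].
Qed.

(* Pivot: rotate the functional c exposing K about K until it touches a new
   point of I. *)
Lemma lin_face_pivot p N (U : 'M[R]_(p, N)) (I K : {set 'I_p})
    (c y : 'cV[R]_N) :
  lin_face U I -> K \proper I ->
  (forall i, (U *m c) i 0 <= 0 ?= iff (i \in K)) -> keep_rows K U *m y = 0 ->
  exists t : R, exists L : {set 'I_p},
    [/\ lin_face U L, K \proper L, L \subset I &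
        forall i, i \in L -> (U *m y) i 0 = t * (U *m c) i 0].
Proof.
move=> fI /properP[KI [i0 i0I i0K]] cK yK.
(* At a row outside [K], [r i] is the multiple of [c] that brings [y] to 0. The largest one over
   [I :\: K] keeps [y + r j *: c] nonpositive on [I] and makes it vanish at [j]. *)
pose r i := (U *m y) i 0 / - (U *m c) i 0.
pose j := [arg max_(i > i0 in I :\: K) r i]%O.
have [jP jmax] : j \in I :\: K /\ forall i, i \in I :\: K -> r i <= r j.
  rewrite /j; case: arg_maxP => [|k kP kmax]; first by rewrite inE i0K.
  by split.
have yK0 i : i \in K -> (U *m y) i 0 = 0.
  move=> iK; have := congr1 (fun M : 'cV_p => M i 0) yK.
  by rewrite keep_rows_mul keep_rowsE iK mul1r !mxE.
have cneg i : i \notin K -> (U *m c) i 0 < 0.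
  by move=> iK; rewrite lt_neqAle (cK i).2 (negbTE iK) (cK i).1.
have valE i : (U *m (y + r j *: c)) i 0 = (U *m y) i 0 + r j * (U *m c) i 0.
  by rewrite mulmxDr -scalemxAr !mxE.
have fle i : i \in I -> (U *m (y + r j *: c)) i 0 <= 0.
  move=> iI; rewrite valE; have [iK|iK] := boolP (i \in K).
    have/eqP : (U *m c) i 0 == 0 by rewrite (cK i).2.
    by move=> ->; rewrite yK0 // mulr0 addr0.
  have := jmax i; rewrite inE iI iK => /(_ isT).
  rewrite {1}/r ler_pdivrMr ?oppr_gt0 ?cneg // mulrN; lra.
exists (- r j), [set i in I | (U *m (y + r j *: c)) i 0 == 0]; split.
- apply: lin_face_trans fI _ _; first by apply/subsetP=> i; rewrite inE => /andP[].
  by move=> i iI; split; [exact: fle | rewrite inE iI].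
- apply/properP; split.
    apply/subsetP=> i iK; rewrite inE (subsetP KI) //= valE yK0 // add0r.
    by have := (cK i).2; rewrite iK => /eqP->; rewrite mulr0.
  move: jP; rewrite inE => /andP[jK jI]; exists j => //.
  have cj0 : (U *m c) j 0 != 0 by rewrite lt_eqF ?cneg.
  by rewrite inE jI /= valE /r invrN mulrN mulNr divfK // subrr.
- by apply/subsetP=> i; rewrite inE => /andP[].
- move=> i; rewrite inE valE => /andP[_]; rewrite addr_eq0 => /eqP->.
  by rewrite mulNr.
Qed.

(** By the pivot and the covering hypothesis, every functional vanishing on [K] is proportional to
    [c] on all of [I]; so the span of [I] modulo that of [K] has dimension at most one. *)
Lemma lin_face_rank_cover p N (U : 'M[R]_(p, N)) (I K : {set 'I_p}) :
  lin_face U I -> lin_face U K -> K \proper I ->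
  (forall L, lin_face U L -> K \proper L -> L \subset I -> L = I) ->
  (\rank (keep_rows I U) <= (\rank (keep_rows K U)).+1)%N.
Proof.
move=> fI [c cK] KI cov.
apply: leq_trans (mxrank_le_mul_ann (keep_rows K U) _) _.
rewrite -addn1 leq_add2l -mxrank_tr.
(* The quotient has rank at most 1 once all its columns are multiples of one column; transposing
   turns this into an inclusion of row spaces. *)
suff /mxrankS/leq_trans : ((keep_rows I U *m ann (keep_rows K U))^T <=
   (keep_rows I U *m c)^T)%MS by apply; rewrite rank_leq_row.
apply/row_subP=> j; rewrite -tr_col colE -mulmxA.
have yK : keep_rows K U *m (ann (keep_rows K U) *m (delta_mx j 0 : 'cV[R]_N)) = 0.
  by rewrite mulmxA mulmx_ann mul0mx.
have [t [L [fL KL LI Lt]]] := lin_face_pivot fI KI cK yK.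
rewrite (cov L fL KL LI) in Lt.
suff -> : keep_rows I U *m (ann (keep_rows K U) *m delta_mx j 0) =
   t *: (keep_rows I U *m c) by rewrite linearZ /= scalemx_sub.
apply/matrixP=> i k; rewrite ord1 keep_rows_mul keep_rowsE !keep_rows_mul.
rewrite [RHS]mxE keep_rowsE mulrCA.
by have [iI|] := boolP (i \in I); [rewrite Lt | rewrite !mul0r].
Qed.

(** The functional exposing [K] kills the span of [K] but not a row of [I] outside [K]. *)
Lemma lin_face_rank_lt p N (U : 'M[R]_(p, N)) (I K : {set 'I_p}) :
  lin_face U K -> K \proper I ->
  (\rank (keep_rows K U) < \rank (keep_rows I U))%N.
Proof.
move=> [c cK] /properP[KI [i iI iK]].
have sKI : (keep_rows K U <= keep_rows I U)%MS.
  by rewrite -(keep_rows_sub U KI) submxMl.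
rewrite ltn_neqAle (mxrankS sKI) andbT; apply/negP.
rewrite (mxrank_leqif_sup sKI).2 => /submxP[D DE].
have Kc0 : keep_rows K U *m c = 0.
  apply/matrixP=> j k; rewrite keep_rows_mul keep_rowsE ord1 [RHS]mxE.
  case: (boolP (j \in K)) => jK; last by rewrite mul0r.
  by have := (cK j).2; rewrite jK => /eqP->; rewrite mulr0.
have := congr1 (fun M => (M *m c) i 0) DE.
rewrite -(mulmxA D) Kc0 mulmx0 keep_rows_mul keep_rowsE iI mul1r [RHS]mxE => /eqP.
by rewrite (cK i).2 (negbTE iK).
Qed.

(* The faces of the cone over P containing the face I are those of the quotient
   of that cone by the span of I. *)
Definition face_figure p N (I : {set 'I_p}) (U : 'M[R]_(p, N)) :
    'M[R]_(#|~: I|, N) :=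
  rowsub (@enum_val _ [in ~: I]) (U *m ann (keep_rows I U)).

Lemma mul_ann_row0 p N (U : 'M[R]_(p, N)) (I : {set 'I_p}) i :
  i \in I -> row i (U *m ann (keep_rows I U)) = 0.
Proof.
move=> iI; have := mulmx_ann (keep_rows I U); rewrite keep_rows_mul => h.
apply/rowP=> j; have := congr1 (fun M : 'M_(p, N) => M i j) h.
by rewrite keep_rowsE iI mul1r !mxE.
Qed.

(** The rows of [I] vanish in the quotient, so deleting them leaves the rank unchanged. *)
Lemma mxrank_face_figure p N (U : 'M[R]_(p, N)) (I : {set 'I_p}) :
  \rank (face_figure I U) = (\rank U - \rank (keep_rows I U))%N.
Proof.
rewrite -mxrank_mul_ann ?submxMl //; apply/eqP; rewrite eqn_leq.
apply/andP; split; apply: mxrankS.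
  by apply/row_subP=> j; rewrite row_rowsub row_sub.
apply/row_subP=> i; case: (boolP (i \in I)) => iI.
  by rewrite mul_ann_row0 // sub0mx.
have iI' : i \in ~: I by rewrite inE.
by rewrite -{1}(enum_rankK_in iI' iI') -row_rowsub row_sub.
Qed.

Lemma lin_face_figure p N (U : 'M[R]_(p, N)) (I K : {set 'I_p}) :
  lin_face U K -> I \subset K ->
  lin_face (face_figure I U) [set j | enum_val j \in K].
Proof.
move=> [c cK] IK.
have /annP[y cy] : keep_rows I U *m c = 0.
  apply/matrixP=> j k; rewrite keep_rows_mul keep_rowsE ord1 [RHS]mxE.
  case: (boolP (j \in I)) => jI; last by rewrite mul0r.
  by have := (cK j).2; rewrite (subsetP IK) // => /eqP->; rewrite mulr0.
exists y => j; rewrite /face_figure mul_rowsub_mx mxE inE -mulmxA -cy.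
exact: cK.
Qed.

Lemma face_figure_lift p N (U : 'M[R]_(p, N)) (I : {set 'I_p})
    (K : {set 'I_(#|~: I|)}) :
  lin_face (face_figure I U) K -> lin_face U (I :|: [set enum_val j | j in K]).
Proof.
move=> [y yK]; exists (ann (keep_rows I U) *m y) => i.
rewrite mulmxA; case: (boolP (i \in I)) => iI.
  have := congr1 (fun r => (r *m y) 0 0) (mul_ann_row0 U iI).
  rewrite -row_mul mul0mx !mxE => ->; rewrite in_setU iI /=.
  by split; rewrite ?lexx ?eqxx.
have iI' : i \in ~: I by rewrite inE.
have iE := enum_rankK_in iI' iI'.
have := yK (enum_rank_in iI' i); rewrite /face_figure mul_rowsub_mx mxE iE.
rewrite in_setU (negbTE iI) /=.
by rewrite -[X in X \in [set _ | _ in _]]iE mem_imset //; exact: enum_val_inj.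
Qed.

End LinearFaces.

(** * Posets modelled by faces of a cone: rank bounds and face figures *)

Section FaceModels.
Import Order.TTheory GRing.Theory Num.Theory.
Local Open Scope ring_scope.
Variable R : realFieldType.

(* f is an isomorphism from (A, le) to the nonempty proper faces of the cone
   spanned by the rows of U. *)
Definition face_model (X : finType) p N (U : 'M[R]_(p, N)) (f : X -> {set 'I_p})
    (le : rel X) (A : {set X}) : Prop :=
  [/\ lin_face U set0,
      forall x, x \in A ->
        [/\ lin_face U (f x), f x != set0 & f x != [set: 'I_p]],
      forall I, lin_face U I -> I != set0 -> I != [set: 'I_p] ->
        exists2 x, x \in A & f x = I,
      {in A &, injective f}
    & {in A &, forall x y, le x y <-> f x \subset f y}].

Section Model.
Variables (X : finType) (p N : nat) (U : 'M[R]_(p, N)) (f : X -> {set 'I_p}).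
Variables (le : rel X) (A : {set X}).
Hypothesis Uf : face_model U f le A.

(** Descending along covers, each step lowers the rank by at most one and [h] by at least one; the
    descent ends at the empty face, of rank 0. *)
Lemma model_rank_height (h : X -> nat) :
  {in A &, forall x y, le x y -> x != y -> (h x < h y)%N} ->
  {in A, forall x, (\rank (keep_rows (f x) U) <= (h x).+1)%N}.
Proof.
have [f0 fA fsurj finj fle] := Uf.
move=> hlt x; have [n] := ubnP (h x); elim: n x => // n IH x hx xA.
have [fx x0 xT] := fA x xA.
(* If no face of the model lies strictly below [f x], then [f x] covers the empty face. *)
case: (pickP [pred y in A | f y \proper f x]) => [y0 y0P|none]; last first.
  suff h1 : (\rank (keep_rows (f x) U) <= (\rank (keep_rows set0 U)).+1)%N.
    by apply: leq_trans h1 _; rewrite keep_rows0 mxrank0.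
  apply: lin_face_rank_cover => // [|L fL]; first by rewrite proper0.
  rewrite proper0 => L0 Lx; apply/eqP/negP=> /negP Lx'.
  have Lp : L \proper f x by rewrite properEneq Lx'.
  have LT : L != [set: 'I_p].
    by apply: contra xT => /eqP LE; rewrite eqEsubset subsetT -LE.
  have [y yA yL] := fsurj L fL L0 LT.
  by have := none y; rewrite /= yA yL Lp.
(* Among the faces strictly below [f x], one with the most rows is covered by [f x]. *)
case: (@arg_maxnP _ y0 [pred y in A | f y \proper f x] (fun y => #|f y|) y0P).
move=> y /andP[/= yA yx] ymax.
have [fy fy0 _] := fA y yA.
have h1 : (\rank (keep_rows (f x) U) <= (\rank (keep_rows (f y) U)).+1)%N.
  apply: lin_face_rank_cover => // L fL yL Lx; apply/eqP/negP=> /negP Lx'.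
  have Lp : L \proper f x by rewrite properEneq Lx'.
  have LT : L != [set: 'I_p].
    by apply: contra xT => /eqP LE; rewrite eqEsubset subsetT -LE.
  have L0 : L != set0.
    by rewrite -proper0; apply: sub_proper_trans yL; rewrite sub0set.
  have [z zA zL] := fsurj L fL L0 LT.
  have := ymax z; rewrite /= zA zL Lp => /(_ isT).
  by rewrite leqNgt proper_card.
have hyx : (h y < h x)%N.
  apply: hlt => //; first by apply/fle => //; exact: proper_sub.
  by apply: contraTneq yx => ->; rewrite properxx.
apply: leq_trans h1 _; rewrite ltnS; apply: leq_trans (hyx).
by apply: IH => //; exact: leq_trans hyx _.
Qed.

(** A maximal element is a facet: the whole cone covers it. *)
Lemma model_rank_maximal x : x \in A -> {in A, forall y, le x y -> y = x} ->
  (\rank U <= (\rank (keep_rows (f x) U)).+1)%N.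
Proof.
have [f0 fA fsurj finj fle] := Uf.
move=> xA xmax; have [fx x0 xT] := fA x xA.
rewrite -{1}(keep_rowsT U); apply: lin_face_rank_cover => //.
- by exists 0 => i; rewrite mulmx0 mxE inE; split; rewrite ?eqxx.
- by rewrite properT.
- move=> L fL xL _; apply/eqP/negP=> /negP LT.
  have L0 : L != set0.
    by rewrite -proper0; apply: sub_proper_trans xL; rewrite sub0set.
  have [y yA yL] := fsurj L fL L0 LT.
  have yx : y = x by apply: xmax => //; apply/fle; rewrite ?yL ?proper_sub.
  by move: xL; rewrite -yL yx properxx.
Qed.

(** A face containing [f e] is determined by its trace off [f e], and functionals on the quotient
    pull back to functionals vanishing on [f e]. The element [e] itself becomes the empty face,
    hence is left out. *)
Lemma face_figure_model e : e \in A ->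
  face_model (face_figure (f e) U) (fun x => [set j | enum_val j \in f x]) le
    [set x in A | le e x && (x != e)].
Proof.
have [f0 fA fsurj finj fle] := Uf.
move=> eA; have [fe e0 eT] := fA e eA.
have val_nin (j : 'I_(#|~: f e|)) : (enum_val j \in f e) = false.
  by apply/negbTE; have := enum_valP j; rewrite inE.
have idxP i : i \notin f e -> exists j : 'I_(#|~: f e|), enum_val j = i.
  move=> ie; have ie' : i \in ~: f e by rewrite inE.
  by exists (enum_rank_in ie' i); rewrite enum_rankK_in.
have subE x y : f e \subset f y ->
    ([set j | enum_val j \in f x] : {set 'I_(#|~: f e|)}) \subset
      [set j | enum_val j \in f y] -> f x \subset f y.
  move=> ey /subsetP s; apply/subsetP=> i ix.
  case: (boolP (i \in f e)) => ie; first exact: (subsetP ey).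
  by have [j jE] := idxP i ie; have := s j; rewrite !inE jE => /(_ ix).
have AP x : x \in [set x in A | le e x && (x != e)] ->
    [/\ x \in A, f e \subset f x & x != e].
  by rewrite inE => /and3P[xA ex xe]; split=> //; apply/(fle e x eA xA).
split.
- suff -> : set0 = [set j | enum_val j \in f e] :> {set 'I_(#|~: f e|)}.
    exact: lin_face_figure.
  by apply/setP=> j; rewrite !inE val_nin.
- move=> x /AP[xA ex xe]; have [fx x0 xT] := fA x xA.
  split; first exact: lin_face_figure.
  + have /properP[_ [i ix ie]] : f e \proper f x.
      rewrite properEneq ex andbT; apply: contra xe => /eqP/finj-> //.
    have [j jE] := idxP i ie.
    by apply/set0Pn; exists j; rewrite inE jE.
  + move: xT; rewrite -properT => /properP[_ [i _ ix]].
    have [j jE] : exists j : 'I_(#|~: f e|), enum_val j = i.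
      by apply: idxP; apply: contra ix; exact: (subsetP ex).
    by apply: contra ix => /eqP/setP/(_ j); rewrite !inE jE.
- move=> K fK K0 KT; have fL := face_figure_lift fK.
  set L := f e :|: _ in fL.
  have memL j : (enum_val j \in L) = (j \in K).
    by rewrite in_setU val_nin /= mem_imset //; exact: enum_val_inj.
  have [x xA xL] : exists2 x, x \in A & f x = L.
    apply: fsurj => //.
    + by apply: contra e0; rewrite setU_eq0 => /andP[].
    + apply: contra KT => /eqP LT; apply/eqP/setP=> j.
      by rewrite -memL LT !inE.
  exists x; last by apply/setP=> j; rewrite inE xL memL.
  rewrite inE xA /=; apply/andP; split.
    by apply/(fle e x eA xA); rewrite xL subsetUl.
  apply: contra K0 => /eqP xe; apply/eqP/setP=> j.
  by rewrite -memL -xL xe val_nin inE.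
- move=> x y /AP[xA ex xe] /AP[yA ey ye] exy; apply: finj => //.
  by apply/eqP; rewrite eqEsubset (subE x y ey) ?(subE y x ex) // exy.
- move=> x y /AP[xA ex xe] /AP[yA ey ye]; split.
    move=> /(fle x y xA yA)/subsetP s; apply/subsetP=> j; rewrite !inE; exact: s.
  by move=> /subE s; apply/(fle x y xA yA); exact: s.
Qed.

Lemma face_model_iso (Y : finType) (le' : rel Y) (B : {set Y}) (h : Y -> X) :
  {in B, forall y, h y \in A} -> {in B &, injective h} ->
  {in A, forall x, exists2 y, y \in B & h y = x} ->
  {in B &, forall y z, le' y z = le (h y) (h z)} ->
  face_model U (f \o h) le' B.
Proof.
have [f0 fA fsurj finj fle] := Uf.
move=> hA hinj hsurj hle; split=> //.
- by move=> y yB; apply/fA/hA.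
- move=> I fI I0 IT; have [x xA <-] := fsurj I fI I0 IT.
  by have [y yB <-] := hsurj x xA; exists y.
- by move=> y z yB zB /= /finj eq; apply: hinj => //; apply: eq; exact: hA.
- by move=> y z yB zB; rewrite hle //; apply: fle; exact: hA.
Qed.

End Model.

Lemma lin_face_mul p N M (U : 'M[R]_(p, N)) (B : 'M[R]_(N, M)) I :
  lin_face (U *m B) I -> lin_face U I.
Proof. by move=> [c cI]; exists (B *m c) => i; rewrite mulmxA. Qed.

End FaceModels.

(** * Convex polytopes as sections of cones *)

Section Polytopes.
Import boolp classical_sets.
Import Order.TTheory GRing.Theory Num.Theory.
Local Open Scope classical_set_scope.
Local Open Scope ring_scope.
Variable R : realType.

(** Points are placed at height 1, so that affine functionals on them become linear. *)
Definition homogenize p N (V : 'M[R]_(p, N)) : 'M[R]_(p, N + 1) :=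
  row_mx V (const_mx 1).

Definition hull p N (V : 'M[R]_(p, N)) (I : {set 'I_p}) : set 'rV[R]_N :=
  [set x | exists w : 'rV[R]_p, [/\ forall i, 0 <= w 0 i, \sum_i w 0 i = 1,
     forall i, i \notin I -> w 0 i = 0 & x = w *m V]].

Lemma dotv_mul N (c x : 'rV[R]_N) : dotv c x = (x *m c^T) 0 0.
Proof. by rewrite mxE; apply: eq_bigr => i _; rewrite mxE mulrC. Qed.

Lemma dotv_row_mul p N (V : 'M[R]_(p, N)) (c : 'rV[R]_N) (w : 'rV[R]_p) :
  dotv c (w *m V) = \sum_i w 0 i * dotv c (row i V).
Proof.
rewrite dotv_mul -mulmxA mxE; apply: eq_bigr => i _; congr (_ * _).
by rewrite dotv_mul -row_mul !mxE.
Qed.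

Lemma lin_face_homogenize p N (V : 'M[R]_(p, N)) (I : {set 'I_p}) :
  lin_face (homogenize V) I <->
  exists (c : 'rV[R]_N) (b : R), forall i, dotv c (row i V) <= b ?= iff (i \in I).
Proof.
have valE (c : 'rV[R]_N) (b : R) i :
    (homogenize V *m col_mx c^T (- b)%:M) i 0 = dotv c (row i V) - b.
  by rewrite mul_row_col mul_mx_scalar dotv_mul -row_mul !mxE mulr1.
split=> [[c0 c0I]|[c [b cI]]]; last first.
  exists (col_mx c^T (- b)%:M) => i; rewrite valE; have [le_b eq_b] := cI i.
  by split; [rewrite subr_le0 | rewrite subr_eq0].
exists (usubmx c0)^T, (- dsubmx c0 0 0) => i.
have [le_b eq_b] := c0I i.
have c0E : c0 = col_mx ((usubmx c0)^T)^T (- - dsubmx c0 0 0)%:M.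
  by rewrite trmxK opprK -mx11_scalar vsubmxK.
rewrite c0E valE subr_le0 in le_b; rewrite c0E valE subr_eq0 in eq_b.
by split.
Qed.

(** At a convex combination the functional takes the weighted average of its values at the rows,
    which is [b] exactly when no weight falls outside [I]. *)
Lemma hull_face p N (V : 'M[R]_(p, N)) (I : {set 'I_p}) (c : 'rV[R]_N) (b : R) :
  (forall i, dotv c (row i V) <= b ?= iff (i \in I)) ->
  (forall x, conv_hull V x -> dotv c x <= b) /\
  hull V I = conv_hull V `&` [set x | dotv c x = b].
Proof.
move=> cI; have key (w : 'rV[R]_p) : (forall i, 0 <= w 0 i) ->
    \sum_i w 0 i = 1 ->
    dotv c (w *m V) <= b ?= iff [forall i, (w 0 i == 0) || (i \in I)].
  move=> w0 w1; rewrite dotv_row_mul -[b]mul1r -w1 mulr_suml.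
  apply: leif_sum => i _; have [le_b eq_b] := cI i; split.
    by rewrite ler_wpM2l.
  by rewrite -subr_eq0 -mulrBr mulf_eq0 subr_eq0 eq_b.
split=> [x [w [w0 w1 ->]]|]; first exact: key.
apply/seteqP; split=> x.
  move=> [w [w0 w1 wI ->]]; split; first by exists w.
  apply/eqP; rewrite (key w w0 w1).2; apply/forallP=> i.
  by case: (boolP (i \in I)) => iI; rewrite ?orbT // wI ?eqxx.
move=> [[w [w0 w1 ->]] /eqP]; rewrite (key w w0 w1).2 => /forallP wI.
by exists w; split=> // i iI; have := wI i; rewrite (negbTE iI) orbF => /eqP.
Qed.

Lemma is_face_conv_hull p N (V : 'M[R]_(p, N)) F :
  is_face (conv_hull V) F <-> exists2 I, lin_face (homogenize V) I & F = hull V I.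
Proof.
split=> [[c [b [le_b FE]]]|[I /lin_face_homogenize[c [b cI]] ->]]; last first.
  by exists c, b; exact: hull_face.
have cI i : dotv c (row i V) <= b ?= iff
    (i \in finset (fun i => dotv c (row i V) == b)).
  split; last by rewrite inE.
  apply: le_b; exists (delta_mx 0 i); split=> [j||].
  - by rewrite mxE eqxx /= ler0n.
  - rewrite (bigD1 i) //= mxE !eqxx big1 ?addr0 // => j ji.
    by rewrite mxE (negbTE ji) andbF.
  - by rewrite -rowE.
exists (finset (fun i => dotv c (row i V) == b)).
  by apply/lin_face_homogenize; exists c, b.
by rewrite FE (hull_face cI).2.
Qed.

Lemma hull_row p N (V : 'M[R]_(p, N)) (I : {set 'I_p}) i :
  lin_face (homogenize V) I -> hull V I (row i V) <-> i \in I.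
Proof.
move=> /lin_face_homogenize[c [b cI]]; split=> [|iI].
  by rewrite (hull_face cI).2 => -[_ /= /eqP]; rewrite (cI i).2.
exists (delta_mx 0 i); split=> [j||j jI|].
- by rewrite mxE eqxx /= ler0n.
- rewrite (bigD1 i) //= mxE !eqxx big1 ?addr0 // => j ji.
  by rewrite mxE (negbTE ji) andbF.
- have ji : j != i by apply: contraNneq jI => ->.
  by rewrite mxE (negbTE ji) andbF.
- by rewrite -rowE.
Qed.

Lemma hull_subset p N (V : 'M[R]_(p, N)) (I J : {set 'I_p}) :
  lin_face (homogenize V) I -> lin_face (homogenize V) J ->
  hull V I `<=` hull V J <-> I \subset J.
Proof.
move=> fI fJ; split=> [IJ|/fintype.subsetP IJ x [w [w0 w1 wI ->]]].
  by apply/fintype.subsetP=> i iI; apply/(hull_row i fJ)/IJ/(hull_row i fI).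
by exists w; split=> // i iJ; apply: wI; apply: contra iJ; exact: IJ.
Qed.

Lemma bdry_faces_conv_hull p N (V : 'M[R]_(p, N)) F :
  bdry_faces (conv_hull V) F <->
  exists I, [/\ lin_face (homogenize V) I, I != finset.set0,
                I != [set: 'I_p]%SET & F = hull V I].
Proof.
have hullT : hull V [set: 'I_p]%SET = conv_hull V.
  apply/seteqP; split=> x [w [w0 w1 wx]]; first by move=> ->; exists w.
  by exists w; split=> // i; rewrite inE.
have fT : lin_face (homogenize V) [set: 'I_p]%SET.
  by exists 0 => i; rewrite mulmx0 mxE inE; split; rewrite ?eqxx.
split=> [[/is_face_conv_hull[I fI ->] [x [w [w0 w1 wI _]]] IT]|[I [fI I0 IT ->]]].
  exists I; split=> //.
    apply/eqP=> I0; suff : \sum_i w 0 i = 0 by move/eqP; rewrite w1 oner_eq0.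
    by apply: big1 => i _; apply: wI; rewrite I0 inE.
  by apply/eqP=> IE; apply: IT; rewrite IE.
split; first by apply/is_face_conv_hull; exists I.
  by have /finset.set0Pn[i iI] := I0; exists (row i V); apply/hull_row.
move=> hT; move: IT; rewrite -finset.subTset => /negP; apply.
by apply/(hull_subset fT fI); rewrite hT hullT.
Qed.

(** The row space is the direct sum of the differences from the first row, with last coordinate 0,
    and the line of [r0], whose last coordinate is 1. *)
Lemma mxrank_homogenize p N (V : 'M[R]_(p.+1, N)) :
  \rank (homogenize V) = (aff_dim V).+1.
Proof.
rewrite /aff_dim; set D := \matrix_i _.
pose r0 : 'rV[R]_(N + 1) := row_mx (row ord0 V) 1.
have rowE i : row i (homogenize V) = row i (row_mx D (0 : 'M_(_, 1))) + r0.
  rewrite !row_row_mx row0 add_row_mx rowK subrK add0r; congr row_mx.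
  by apply/matrixP=> a b; rewrite !mxE !ord1.
have eqU : (homogenize V :=: row_mx D (0 : 'M_(_, 1)) + r0)%MS.
  apply/eqmxP/andP; split.
    apply/row_subP=> i; rewrite rowE.
    exact: submx_trans (addmx_sub_adds (row_sub _ _) (submx_refl _)) _.
  have r0E : r0 = row ord0 (homogenize V).
    by rewrite rowE row_row_mx rowK subrr row0 row_mx0 add0r.
  rewrite addsmx_sub r0E row_sub andbT; apply/row_subP=> i.
  have -> : row i (row_mx D (0 : 'M_(_, 1))) = row i (homogenize V) - r0.
    by rewrite rowE addrK.
  by rewrite r0E addmx_sub ?eqmx_opp ?row_sub.
rewrite eqU mxrank_disjoint_sum.
  suff r00 : r0 != 0 by rewrite rank_row_mx0 rank_rV r00 addn1.
  apply/eqP=> /(congr1 (fun M : 'rV_(N + 1) => rsubmx M 0 0)).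
  by rewrite row_mxKr linear0 !mxE => /eqP; rewrite oner_eq0.
apply/eqP; rewrite -submx0; apply/rV_subP=> v; rewrite sub_capmx submx0.
move=> /andP[/submxP[w wE] /sub_rVP[a aE]].
have : a = 0.
  have := congr1 (fun M : 'rV_(N + 1) => rsubmx M 0 0) wE.
  rewrite aE linearZ /= row_mxKr mul_mx_row row_mxKr mulmx0 !mxE.
  by rewrite eqxx mulr1.
by rewrite aE => ->; rewrite scale0r.
Qed.

(** Affine geometry is traded for linear algebra: dimension [k] becomes rank [k.+1] of the cone over
    the polytope. Conversely, a functional exposing [set0] yields a hyperplane section that is a
    polytope with the same faces. *)
Lemma polytopalP k (X : finType) (le : rel X) (A : {set X}) :
  polytopal R k le A <->
  exists p N (U : 'M[R]_(p, N)) f, face_model U f le A /\ \rank U = k.+1.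
Proof.
split.
  move=> [N [P [[p [V [dimV ->]]] [phi [[phiA phiI phiS] phile]]]]].
  pose f x := finset (fun i => `[< phi x (row i V) >]).
  have fE x : x \in A -> [/\ lin_face (homogenize V) (f x),
      f x != finset.set0, f x != [set: 'I_p.+1]%SET & phi x = hull V (f x)].
    move=> xA; have /bdry_faces_conv_hull[I [fI I0 IT phiE]] := phiA x xA.
    suff -> : f x = I by [].
    apply/setP=> i; rewrite inE phiE; apply/asboolP/idP; by move/(hull_row i fI).
  exists p.+1, (N + 1)%N, (homogenize V), f.
  split; last by rewrite mxrank_homogenize dimV.
  split.
  (* The constant affine functional -1 exposes the empty face. *)
  - apply/lin_face_homogenize; exists 0, 1 => i.
    rewrite dotv_mul trmx0 mulmx0 mxE inE.
    by split; rewrite ?ler01 // eq_sym oner_eq0.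
  - by move=> x xA; have [] := fE x xA.
  - move=> I fI I0 IT.
    have [x xA phix] : exists2 x, x \in A & phi x = hull V I.
      have [|x xA xE] := phiS (hull V I); last by exists x.
      by apply/bdry_faces_conv_hull; exists I.
    exists x => //; have [fx _ _ phiE] := fE x xA; rewrite phiE in phix.
    apply/eqP; rewrite finset.eqEsubset; apply/andP.
    by split; apply/(hull_subset (V := V)); rewrite ?phix.
  - move=> x y xA yA fxy; apply: phiI; rewrite ?inE //.
    by have [_ _ _ ->] := fE x xA; have [_ _ _ ->] := fE y yA; rewrite fxy.
  - move=> x y xA yA; rewrite phile //.
    have [fx _ _ ->] := fE x xA; have [fy _ _ ->] := fE y yA.
    exact: hull_subset.
move=> [[|p] [N [U [f [Uf rkU]]]]]; first by have := rank_leq_row U; rewrite rkU.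
have [[c c0] fA fsurj finj fle] := Uf.
have cneg i : 0 < - (U *m c) i 0.
  by rewrite oppr_gt0 lt_neqAle (c0 i).2 inE (c0 i).1.
(* Each row is rescaled to the hyperplane where c takes the value -1. *)
pose D := \row_i (- (U *m c) i 0)^-1.
pose Q := diag_mx D *m U.
have QE (B : 'cV[R]_N) i : (Q *m B) i 0 = (- (U *m c) i 0)^-1 * (U *m B) i 0.
  by rewrite /Q -mulmxA mul_diag_mx mxE [D _ _]mxE.
(* [Q] and [homogenize Q] are right multiples of each other, hence have the same faces and the same
   rank. *)
have homQ : homogenize Q = Q *m row_mx 1%:M (- c).
  rewrite mul_mx_row mulmx1; congr row_mx; apply/matrixP=> i j.
  rewrite ord1 QE [LHS]mxE.
  have -> : (U *m - c) i 0 = - (U *m c) i 0 by rewrite mulmxN mxE.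
  by rewrite mulVf // gt_eqF.
have Qhom : Q = homogenize Q *m col_mx 1%:M 0.
  by rewrite mul_row_col mulmx1 mulmx0 addr0.
have fQ I : lin_face (homogenize Q) I <-> lin_face U I.
  have -> : lin_face (homogenize Q) I <-> lin_face Q I.
    split; first by rewrite homQ => /lin_face_mul.
    by rewrite {1}Qhom => /lin_face_mul.
  split=> -[y yI]; exists y => i; have [le0 eq0] := yI i; split.
  - by rewrite QE pmulr_rle0 ?invr_gt0 // in le0.
  - by rewrite QE mulf_eq0 invr_eq0 gt_eqF //= in eq0.
  - by rewrite QE pmulr_rle0 ?invr_gt0.
  - by rewrite QE mulf_eq0 invr_eq0 gt_eqF.
have dimQ : aff_dim Q = k.
  apply: succn_inj; rewrite -mxrank_homogenize -rkU.
  have <- : \rank Q = \rank U.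
    suff fD : row_full (diag_mx D) by rewrite (eqmxMfull _ fD).
    rewrite row_full_unit unitmxE det_diag unitfE.
    by apply/prodf_neq0=> i _; rewrite mxE invr_eq0 gt_eqF.
  apply/eqP; rewrite eqn_leq {1}homQ mxrankM_maxl /= {1}Qhom.
  exact: mxrankM_maxl.
exists N, (conv_hull Q); split; first by exists p, Q.
exists (fun x => hull Q (f x)); split; last first.
  move=> x y xA yA; rewrite fle // hull_subset //; apply/fQ.
    by have [] := fA x xA.
  by have [] := fA y yA.
split.
- move=> x xA; apply/bdry_faces_conv_hull; exists (f x).
  by have [fx x0 xT] := fA x xA; split=> //; apply/fQ.
- move=> x y /set_mem xA /set_mem yA hxy; apply: finj => //.
  have [fx _ _] := fA x xA; have [fy _ _] := fA y yA.
  move: fx fy => /fQ fx /fQ fy.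
  apply/eqP; rewrite finset.eqEsubset; apply/andP.
  by split; apply/(hull_subset (V := Q)); rewrite ?hxy.
- move=> F /bdry_faces_conv_hull[I [/fQ fI I0 IT ->]].
  by have [x xA <-] := fsurj I fI I0 IT; exists x.
Qed.
End Polytopes.

(** * Sign vectors: order, zero sets and the last coordinate *)

Section SignVectors.
Implicit Types m : nat.

Lemma sv_leP m (s t : signvec m) :
  reflect (forall j, t j != sg0 -> s j = t j) (sv_le s t).
Proof.
apply: (iffP forallP) => h j; first by move=> tj; have := h j; rewrite tj => /eqP.
by apply/implyP=> /h->.
Qed.

Lemma sv_le_trans m (s t u : signvec m) : sv_le s t -> sv_le t u -> sv_le s u.
Proof.
move=> /sv_leP st /sv_leP tu; apply/sv_leP=> j uj.
by rewrite -(tu _ uj) st // (tu _ uj).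
Qed.

Lemma card_zeros_lt m (s t : signvec m) :
  sv_le s t -> s != t -> #|zeros s| < #|zeros t|.
Proof.
move=> /sv_leP st ne; apply: proper_card.
have sub : zeros s \subset zeros t.
  apply/subsetP=> j; rewrite !inE; apply: contraLR => tj.
  by rewrite (st _ tj).
rewrite properEneq sub andbT; apply: contra ne => /eqP zst.
apply/eqP/ffunP=> j; have [tj|tj] := eqVneq (t j) sg0; last exact: st.
by move/setP/(_ j): zst; rewrite !inE tj eqxx => /eqP.
Qed.

Lemma sv_rcons_max m (s : signvec m) e : sv_rcons s e ord_max = e.
Proof. by rewrite ffunE unlift_none. Qed.

Lemma sv_rcons_lift m (s : signvec m) e i : sv_rcons s e (lift ord_max i) = s i.
Proof. by rewrite ffunE liftK. Qed.

Lemma sv_rconsP m (x : signvec m.+1) : exists s e, x = sv_rcons s e.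
Proof.
exists [ffun i => x (lift ord_max i)], (x ord_max); apply/ffunP=> j.
by case: (unliftP ord_max j) => [i|] ->; rewrite ?sv_rcons_max // sv_rcons_lift ffunE.
Qed.

Lemma sv_rcons_inj m (s t : signvec m) e e' :
  sv_rcons s e = sv_rcons t e' -> s = t /\ e = e'.
Proof.
move=> h; split; last by have := congr1 (fun x : signvec m.+1 => x ord_max) h;
  rewrite /= !sv_rcons_max.
apply/ffunP=> i.
by have := congr1 (fun x : signvec m.+1 => x (lift ord_max i)) h;
  rewrite /= !sv_rcons_lift.
Qed.

Lemma sv_le_rcons m (s t : signvec m) e e' :
  sv_le (sv_rcons s e) (sv_rcons t e') =
  sv_le s t && ((e' != sg0) ==> (e == e')).
Proof.
apply/sv_leP/andP => [h|[/sv_leP h /implyP h'] j].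
  split; first by apply/sv_leP=> j; have := h (lift ord_max j);
    rewrite !sv_rcons_lift.
  by apply/implyP=> e0; have := h ord_max; rewrite !sv_rcons_max => /(_ e0)->.
by case: (unliftP ord_max j) => [i|] ->; rewrite ?sv_rcons_max ?sv_rcons_lift;
  [exact: h | move/h'/eqP].
Qed.

Lemma card_zeros_rcons m (s : signvec m) e :
  #|zeros (sv_rcons s e)| = (e == sg0) + #|zeros s|.
Proof.
rewrite -(card_imset (zeros s) (@lift_inj _ ord_max)) (cardsD1 ord_max (zeros _)).
rewrite inE sv_rcons_max; congr (_ + _); apply: eq_card => j.
case: (unliftP ord_max j) => [i|] ->.
  by rewrite !inE sv_rcons_lift eq_sym neq_lift (mem_imset _ _ (@lift_inj _ _)) inE.
rewrite !inE eqxx /=; apply/esym/negbTE/imsetP=> -[i _] /eqP.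
by rewrite (negbTE (neq_lift _ _)).
Qed.

(** The nonnegative sign vectors embed the subsets of the ground set into the faces of the cube, as
    those above the vertex [pos_vec set0]. *)
Definition pos_vec m (Z : {set 'I_m}) : signvec m :=
  [ffun j => if j \in Z then sg0 else sgP].

Lemma zeros_pos_vec m (Z : {set 'I_m}) : zeros (pos_vec Z) = Z.
Proof. by apply/setP=> j; rewrite inE ffunE; case: ifP. Qed.

Lemma sv_le_pos_vec m (Z Z' : {set 'I_m}) :
  sv_le (pos_vec Z) (pos_vec Z') = (Z \subset Z').
Proof.
apply/sv_leP/subsetP=> h j; last first.
  rewrite !ffunE; case: ifPn => // jZ' _.
  by rewrite (contraNF (h j) jZ').
move=> jZ; apply: contraT => jZ'.
by have := h j; rewrite !ffunE jZ (negbTE jZ') => /(_ isT).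
Qed.

Lemma pos_vec_zeros m (s : signvec m) :
  sv_le (pos_vec set0) s -> s = pos_vec (zeros s).
Proof.
move=> /sv_leP h; apply/ffunP=> j; rewrite ffunE inE.
by case: eqVneq => [//|/h <-]; rewrite ffunE inE.
Qed.

End SignVectors.

(** * Boundaries of simplices and of cones *)

Section Boundary.
Implicit Types m e : nat.

Lemma bdry_sub e m (D : {set {set 'I_m}}) (F G : {set 'I_m}) :
  G \in bdry e D -> F \subset G -> F \in bdry e D.
Proof.
rewrite !inE => /existsP[H /and4P[HD He GH H1]] FG.
by apply/existsP; exists H; rewrite HD He (subset_trans FG GH).
Qed.

Lemma bdry_card e m (D : {set {set 'I_m}}) (F : {set 'I_m}) :
  F \in bdry e D -> #|F| <= e.
Proof.
by rewrite inE => /existsP[G /and4P[_ /eqP<- FG _]]; exact: subset_leq_card.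
Qed.

(** A proper face misses some [i], so it lies in the complement of [i], whose only superset with
    [e.+1] elements is the full set. *)
Lemma bdry_full_simplex e (F : {set 'I_e.+1}) :
  (F \in bdry e (full_simplex e.+1)) = (F != [set: 'I_e.+1]).
Proof.
apply/idP/idP => [/bdry_card|].
  by apply: contraTneq => ->; rewrite cardsT card_ord ltnn.
rewrite -properT => /properP[_ [i _ iF]].
rewrite inE; apply/existsP; exists (~: [set i]); rewrite !inE /=.
have Gc : #|~: [set i]| = e.
  by have := cardsC1 i; rewrite card_ord.
rewrite Gc eqxx /=; apply/andP; split.
  by apply/subsetP=> j jF; rewrite !inE; apply: contraNneq iF => <-.
rewrite (_ : [set H in _ | _] = [set [set: 'I_e.+1]]) ?cards1 //.
apply/setP=> H; rewrite !inE /=; apply/andP/eqP => [[/eqP cH _]|->].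
  by apply/eqP; rewrite eqEcard subsetT cardsT card_ord cH leqnn.
by rewrite cardsT card_ord eqxx subsetT.
Qed.

(** The trace on the base of a cone: [cone B] consists of the [F] with [base F \in B]. *)
Definition base m (F : {set 'I_m.+1}) : {set 'I_m} :=
  [set j | widen_ord (leqnSn m) j \in F].

Lemma widen_lift_max m (i : 'I_m) : widen_ord (leqnSn m) i = lift ord_max i.
Proof. by apply: val_inj; rewrite /= /bump leqNgt ltn_ord. Qed.

Lemma card_base m (F : {set 'I_m.+1}) : #|F| = (ord_max \in F) + #|base F|.
Proof.
rewrite (cardsD1 ord_max F); congr (_ + _).
rewrite -(card_imset (base F) (@lift_inj _ ord_max)); apply: eq_card => j.
case: (unliftP ord_max j) => [i|] ->.
  by rewrite !inE eq_sym neq_lift (mem_imset _ _ (@lift_inj _ _)) inE widen_lift_max.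
rewrite !inE eqxx /=; apply/esym/negbTE/imsetP=> -[i _] /eqP.
by rewrite (negbTE (neq_lift _ _)).
Qed.

Lemma base_inj m (F G : {set 'I_m.+1}) :
  base F = base G -> (ord_max \in F) = (ord_max \in G) -> F = G.
Proof.
move=> /setP FG maxE; apply/setP=> j.
case: (unliftP ord_max j) => [i|] -> //; have := FG i.
by rewrite !inE widen_lift_max.
Qed.

(** The face [F], placed in the base, is a boundary ridge: a face with [e.+1] vertices above it has
    a trace in [B] of at most [e] vertices, which must be [F], so it is [F] plus the apex. *)
Lemma bdry_cone_neq0 e m (B : {set {set 'I_m}}) (F : {set 'I_m}) :
  (forall G : {set 'I_m}, G \in B -> #|G| <= e) -> F \in B -> #|F| = e ->
  set0 \in bdry e (cone B).
Proof.
move=> Be FB Fe.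
pose G : {set 'I_m.+1} := [set widen_ord (leqnSn m) j | j in F].
have winj : injective (widen_ord (leqnSn m)).
  by move=> i j /(congr1 val)/= ij; exact: val_inj.
have Gb : base G = F by apply/setP=> j; rewrite inE mem_imset.
have Gmax : ord_max \in G = false.
  apply/negP=> /imsetP[j _ /(congr1 val)/= jm].
  by have := ltn_ord j; rewrite -jm ltnn.
have bM : base (ord_max |: G) = F.
  apply/setP=> j; rewrite -Gb !inE.
  by rewrite -val_eqE /= ltn_eqF.
rewrite inE; apply/existsP; exists G; rewrite inE -/(base G) Gb FB sub0set /=.
rewrite card_base Gmax Gb Fe eqxx /=.
rewrite (_ : [set H in _ | _] = [set ord_max |: G]) ?cards1 //.
apply/setP=> H; rewrite !inE -/(base H); apply/and3P/eqP => [[HB /eqP Hc GH]|->].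
  have FH : F = base H.
    apply/eqP; rewrite eqEcard Fe Be // andbT -Gb.
    by apply/subsetP=> j; rewrite !inE; exact: (subsetP GH).
  apply: base_inj; first by rewrite bM.
  rewrite setU11; have := Hc; rewrite card_base -FH Fe.
  by case: (ord_max \in H) => // /eqP; rewrite ltn_eqF.
by rewrite bM FB card_base setU11 bM Fe subsetUr.
Qed.

End Boundary.

(** * Membership in the spheres by last sign *)

Section Spheres.
Variables (d : nat) (T : forall i, {set {set 'I_i}}).
Hypotheses (d_gt0 : 0 < d) (Td : T d = full_simplex d).

(** The recursive description also fits the initial sphere, the case [m = d]: the boundary of the
    full simplex consists of all proper subsets, matching the boundary of the cube. *)
Lemma bbc_sphere_max0 m s : d <= m ->
  (sv_rcons s sg0 \in bbc_sphere d T m.+1) = (zeros s \in bdry d.-1 (T m)).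
Proof.
move=> dm; move: dm s; rewrite leq_eqVlt => /predU1P[<-|dm] s.
  rewrite /= leqnn Td; case: d d_gt0 s => // e _ s.
  rewrite bdry_full_simplex inE; congr (~~ _).
  by rewrite !eqEcard !subsetT !cardsT !card_ord card_zeros_rcons eqxx ltnS.
rewrite /= leqNgt dm /=; apply/idP/idP => [|sD].
  by case/setUP=> [/setUP[]|] /imsetP[t +] /sv_rcons_inj[-> //]; rewrite inE.
by apply/setUP; left; apply/setUP; right; apply: imset_f; rewrite inE.
Qed.

Lemma bbc_sphere_maxP m s : d <= m ->
  (sv_rcons s sgP \in bbc_sphere d T m.+1) = (zeros s \in T m).
Proof.
move=> dm; move: dm s; rewrite leq_eqVlt => /predU1P[<-|dm] s.
  rewrite /= leqnn Td !inE eqEcard subsetT cardsT card_ord card_zeros_rcons /=.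
  by rewrite -ltnNge ltnS -[X in _ <= X](card_ord d) max_card.
rewrite /= leqNgt dm /=; apply/idP/idP => [|sD].
  by case/setUP=> [/setUP[]|] /imsetP[t +] /sv_rcons_inj[-> //]; rewrite inE.
by apply/setUP; left; apply/setUP; left; apply: imset_f; rewrite inE.
Qed.

Lemma bdry_neq0_of_facet m (F : {set 'I_m}) : d <= m ->
  (forall i, d <= i -> i.+1 = m ->
     exists2 B : {set {set 'I_i}}, B \subset bdry d.-1 (T i) & T i.+1 = cone B) ->
  F \in T m -> d <= #|F| -> set0 \in bdry d.-1 (T m).
Proof.
move=> dm; move: dm F; rewrite leq_eqVlt => /predU1P[<-|dm] F.
  rewrite Td => _ _ _; case: d d_gt0 => // e _; rewrite bdry_full_simplex.
  by apply/eqP=> /setP/(_ ord0); rewrite !inE.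
case: m dm F => // i di F /(_ i di erefl)[B Bsub ->] FB dF.
(* Faces of [B] have at most [d.-1] vertices, so the trace of a face of the cone with at least [d]
   vertices has exactly [d.-1]. *)
have Be G : G \in B -> #|G| <= d.-1 by move/(subsetP Bsub)/bdry_card.
have FB' : base F \in B by move: FB; rewrite inE.
apply: (bdry_cone_neq0 Be FB'); apply/eqP; rewrite eqn_leq Be //=.
move: dF; rewrite card_base; case: d d_gt0 => // e _ /=.
by case: (_ \in F) => //= /ltnW.
Qed.

End Spheres.

(** * The face figure at an edge of the polytope *)

Theorem theorem3p7 (R : realType) (d n : nat)
    (T : forall i : nat, {set {set 'I_i}}) :
  3 <= d -> d < n ->
  bbc_sequence R d n T ->
  polytopal R d.+1 (@sv_le n) (bbc_sphere d T n) ->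
  polytopal R d.-1 (@face_le n.-1) (nonempty_faces (bdry d.-1 (T n.-1))).
Proof.
case: n => // m d3; rewrite ltnS => dm [ball Td coneT].
have d0 : 0 < d by apply: leq_trans d3.
move=> /polytopalP[p [N [U [f [Uf rkU]]]]]; apply/polytopalP => /=.
have height := model_rank_height Uf (h := fun x => #|zeros x|)
  (fun x y _ _ => @card_zeros_lt _ x y).
pose x0 := sv_rcons (pos_vec (set0 : {set 'I_m})) sgP.
have x0S : x0 \in bbc_sphere d T m.+1.
  rewrite bbc_sphere_maxP // zeros_pos_vec.
  by have [|[[]]] := ball m; first by rewrite dm leqnn.
have bd0 : set0 \in bdry d.-1 (T m).
  (* A face above [x0] with the most zeros is maximal, so it is a facet, of rank at least [d.+1];
     the height bound then gives at least [d] zeros. *)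
  case: (@arg_maxnP _ x0 [pred x in bbc_sphere d T m.+1 | sv_le x0 x]
           (fun x => #|zeros x|)).
    by rewrite /= x0S; apply/sv_leP.
  move=> x /andP[/= xS x0x] xmax.
  have dz : d <= #|zeros x|.
    rewrite -2!ltnS -rkU; apply: leq_trans (model_rank_maximal Uf xS _) _.
      move=> y yS xy; apply/eqP/negP=> /negP yx.
      have := xmax y; rewrite /= yS (sv_le_trans x0x xy) => /(_ isT).
      by rewrite leqNgt card_zeros_lt // eq_sym.
    by rewrite ltnS height.
  have [s [e xE]] := sv_rconsP x; rewrite {}xE in xS x0x dz.
  move: x0x; rewrite sv_le_rcons => /andP[_].
  (* Lying above [x0], the facet has last sign 0 or +; sign 0 puts its zero set directly in the
     boundary. *)
  case: (eqVneq e sg0) => [e0 _|e0 /= /eqP e1].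
    by move: xS; rewrite e0 bbc_sphere_max0 // => /bdry_sub-> //; exact: sub0set.
  move: xS dz; rewrite -e1 bbc_sphere_maxP // card_zeros_rcons /= add0n => sT dz.
  apply: (bdry_neq0_of_facet d0 Td dm _ sT dz) => i di im.
  by have [|B [_ _ Bsub ->]] := coneT i di; [rewrite im | exists B].
pose edge Z : signvec m.+1 := sv_rcons (pos_vec Z) sg0.
have edgeS Z : (edge Z \in bbc_sphere d T m.+1) = (Z \in bdry d.-1 (T m)).
  by rewrite bbc_sphere_max0 // zeros_pos_vec.
have edge_le Z Z' : sv_le (edge Z) (edge Z') = (Z \subset Z').
  by rewrite sv_le_rcons andbT sv_le_pos_vec.
have edge_inj : injective edge.
  move=> Z Z' /sv_rcons_inj[/(congr1 (@zeros m))].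
  by rewrite !zeros_pos_vec.
have eS : edge set0 \in bbc_sphere d T m.+1 by rewrite edgeS.
(* The single zero of the edge bounds its rank by 2, and the chain from the empty face through [x0]
   to the edge forces rank at least 2. *)
have rk_edge : \rank (keep_rows (f (edge set0)) U) = 2.
  apply/eqP; rewrite eqn_leq; apply/andP; split.
    apply: leq_trans (height _ eS) _.
    by rewrite card_zeros_rcons zeros_pos_vec cards0.
  have [f0 fA _ finj fle] := Uf; have [fx0 x0_neq0 _] := fA _ x0S.
  have lt_x0 : f x0 \proper f (edge set0).
    rewrite properEneq; apply/andP; split.
      by apply/eqP=> /finj-/(_ x0S eS)/sv_rcons_inj[].
    by apply/(fle _ _ x0S eS); rewrite sv_le_rcons andbT; apply/sv_leP.
  apply: leq_ltn_trans (lin_face_rank_lt fx0 lt_x0).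
  by apply: leq_ltn_trans (lin_face_rank_lt f0 _); rewrite ?proper0.
exists _, N, (face_figure (f (edge set0)) U),
  ((fun x => [set j | enum_val j \in f x]) \o edge).
(* The rank of the figure is [d.+2 - 2 = d], which is one more than the dimension [d.-1]. *)
split; last by rewrite mxrank_face_figure rkU rk_edge prednK // subn2.
apply: (face_model_iso (face_figure_model Uf eS)).
- move=> Z; rewrite in_setD1 => /andP[Z0 ZD].
  by rewrite inE edgeS ZD edge_le sub0set (inj_eq edge_inj).
- by move=> Z Z' _ _; exact: edge_inj.
(* A sign vector above the edge has nonnegative entries and last sign 0, so its zero set determines
   it. *)
- move=> x; rewrite inE => /and3P[xS ex xe].
  have [s [e xE]] := sv_rconsP x; move: ex; rewrite {1}xE sv_le_rcons.
  move=> /andP[/pos_vec_zeros sE /implyP e0].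
  have xE' : edge (zeros s) = x.
    rewrite xE {2}sE; congr sv_rcons.
    by case: (eqVneq e sg0) => [->|/e0/eqP].
  exists (zeros s) => //; rewrite /nonempty_faces in_setD1 -edgeS xE' xS andbT.
  by apply: contra xe => /eqP z0; rewrite -xE' z0.
- by move=> Z Z' _ _; rewrite edge_le.
Qed.
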